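(* There exists an infinite $(7/3)^+$-power-free word $\mathbf{w}$ over $\{0,1\}$ that contains arbitrarily large squares beginning at every position; that is, for every position $i$ of $\mathbf{w}$ and every $N$, there is a square of length at least $N$ occurring in $\mathbf{w}$ beginning at position $i$.
   Context: A finite word $w$ is an $\alpha$-power ($\alpha$ rational) if $w = x^n x'$ with $x$ nonempty, $x'$ a prefix of $x$, and $\alpha = n + |x'|/|x|$. An $\alpha^+$-power is a word that is a $\beta$-power for some $\beta>\alpha$. A word is $\alpha^+$-power-free if none of its factors (contiguous subwords) is an $\alpha^+$-power. A square is a word $xx$ with $x$ nonempty. *)

(* Defs.v *)
From mathcomp Require Import all_boot.
Set Implicit Arguments. Unset Strict Implicit. Unset Printing Implicit Defensive.

Definition factor (w : nat -> bool) (i m : nat) : seq bool :=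
  mkseq (fun k => w (i + k)) m.

(* u = x^n x' with x of length p (p > 0), n >= 1, x' a proper-or-not prefix of x.
   Then the exponent is size u / p. *)
Definition is_power_with_period (u : seq bool) (p : nat) : Prop :=
  exists (x x' : seq bool) (n : nat),
    0 < size x /\ size x = p /\ 0 < n /\ prefix x' x /\
    u = flatten (nseq n x) ++ x'.

(* u is a beta-power for some beta > a/b (b > 0), i.e. an (a/b)^+-power:
   exponent size u / p > a / b  <=>  a * p < b * size u. *)
Definition is_plus_power (a b : nat) (u : seq bool) : Prop :=
  exists p, is_power_with_period u p /\ a * p < b * size u.

Definition plus_power_free (a b : nat) (w : nat -> bool) : Prop :=
  forall i m, ~ is_plus_power a b (factor w i m).

Definition is_square (u : seq bool) : Prop :=
  exists x : seq bool, 0 < size x /\ u = x ++ x.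

(* Main.v *)
(** Let [f] be the 19-uniform morphism sending 0 to 0110100110110010110 and 1 to
    the complementary block. Since [f 0] carries the letter 0 at index 6, as the
    first letter of the factor 0110110, there is a bi-infinite word W with
    W = f(W) whose origin sits at index 6 of the image of the letter at the
    origin; [word] is its right half. For every n the origin lies in an occurrence
    of [f^n(0110110)], at distance (19^n - 1)/3 from its left end, and all of
    the first 19^n + 1 positions of that occurrence begin squares of period
    3 * 19^n: this gives the large squares.
    A factor of exponent > 7/3 and period p is a run of more than 4p/3
    consecutive equalities W(j) = W(j + p). If 19 divides p, one letter of a
    block determines the letter it comes from, so the run desubstitutes to one
    of period p/19. Otherwise p < 9, because 13 consecutive letters of [word]
    determine their position modulo 19, and short periods are excluded by
    inspecting the images of two-letter words. *)
Require Import Defs.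
From mathcomp Require Import all_boot zify.

Definition block : seq bool :=
  [:: false; true; true; false; true; false; false; true; true; false;
      true; true; false; false; true; false; true; true; false].

(* The fuel n bounds the number of desubstitutions. *)
Fixpoint word_rec (n i : nat) : bool :=
  if n is n'.+1 then
    word_rec n' ((i + 6) %/ 19) (+) nth false block ((i + 6) %% 19)
  else false.

Definition word (i : nat) : bool := word_rec i i.

Lemma word_rec0 n : word_rec n 0 = false.
Proof. by elim: n => //= n ->. Qed.

(** The recursion goes to [(i + 6) %/ 19], below [i] when [i > 0]; at 0 any fuel gives [false]. *)
Lemma word_rec_fuel n i : i <= n -> word_rec n i = word i.
Proof.
elim/ltn_ind: n i => -[|n] IHn [|i] lein //; first by rewrite word_rec0.
rewrite /word /=; congr (_ (+) _).
rewrite IHn //; last by lia.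
by rewrite [RHS]IHn //; lia.
Qed.

Lemma wordE i :
  word i = word ((i + 6) %/ 19) (+) nth false block ((i + 6) %% 19).
Proof.
case: i => [|i] //; rewrite [LHS]/word /=.
by rewrite word_rec_fuel //; lia.
Qed.

(* The letter of index s in the image of the two-letter word ac. *)
Definition image2 (a c : bool) (s : nat) : bool :=
  (if s < 19 then a else c) (+) nth false block (s %% 19).

Lemma word_image2 i k : (i + 6) %% 19 + k < 38 ->
  word (i + k) =
  image2 (word ((i + 6) %/ 19)) (word ((i + 6) %/ 19).+1) ((i + 6) %% 19 + k).
Proof.
move=> lt38; rewrite wordE /image2; congr (_ (+) nth _ _ _); last by lia.
by case: ifP => ?; congr word; lia.
Qed.

Definition bools : seq bool := [:: false; true].

Lemma mem_bools b : b \in bools. Proof. by case: b. Qed.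

Definition synchronizing_check : bool :=
  all (fun a => all (fun c => all (fun a' => all (fun c' =>
  all (fun t => all (fun t' => (t == t') ||
    ~~ all (fun k => image2 a c (t + k) == image2 a' c' (t' + k)) (iota 0 13))
  (iota 0 19)) (iota 0 19)) bools) bools) bools) bools.

Definition short_period_check : bool :=
  all (fun a => all (fun c => all (fun t => all (fun p =>
    ~~ all (fun k => image2 a c (t + k) == image2 a c (t + (k + p)))
           (iota 0 (4 * p %/ 3).+1))
  (iota 1 8)) (iota 0 19)) bools) bools.

Lemma synchronizing_checkT : synchronizing_check.
Proof. by vm_compute. Qed.

Lemma short_period_checkT : short_period_check.
Proof. by vm_compute. Qed.

Lemma word_synchronizing i j :
  (forall k, k < 13 -> word (i + k) = word (j + k)) -> i = j %[mod 19].
Proof.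
move=> eqw.
have ti : (i + 6) %% 19 \in iota 0 19 by rewrite mem_iota ltn_pmod.
have tj : (j + 6) %% 19 \in iota 0 19 by rewrite mem_iota ltn_pmod.
have /allP/(_ _ (mem_bools (word ((i + 6) %/ 19)))) := synchronizing_checkT.
move=> /allP/(_ _ (mem_bools (word ((i + 6) %/ 19).+1))).
move=> /allP/(_ _ (mem_bools (word ((j + 6) %/ 19)))).
move=> /allP/(_ _ (mem_bools (word ((j + 6) %/ 19).+1))).
move=> /allP/(_ _ ti)/allP/(_ _ tj)/orP[/eqP|/negP[]]; first by lia.
apply/allP => k; rewrite mem_iota => /andP[_ ltk].
by rewrite -!word_image2 ?eqw //; lia.
Qed.

Lemma word_no_short_period i p : 0 < p < 9 ->
  ~ (forall k, 3 * k <= 4 * p -> word (i + k) = word (i + k + p)).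
Proof.
move=> p_bd eqw.
have t_in : (i + 6) %% 19 \in iota 0 19 by rewrite mem_iota ltn_pmod.
have p_in : p \in iota 1 8 by rewrite mem_iota.
have /allP/(_ _ (mem_bools (word ((i + 6) %/ 19)))) := short_period_checkT.
move=> /allP/(_ _ (mem_bools (word ((i + 6) %/ 19).+1))).
move=> /allP/(_ _ t_in)/allP/(_ _ p_in)/negP[].
apply/allP => k; rewrite mem_iota => /andP[_ ltk].
by rewrite -!word_image2 ?addnA ?eqw //; lia.
Qed.

Lemma word_no_long_run p i r : 0 < p -> 4 * p < 3 * r ->
  ~ (forall k, k < r -> word (i + k) = word (i + k + p)).
Proof.
elim/ltn_ind: p i r => p IHp i r p_gt0 ltpr eqw.
have [/dvdnP[q def_p] | ndvd] := boolP (19 %| p).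
  pose i' := (i + 6) %/ 19.
  (* One equality for each block met by the positions from [i] to [i + r - 1]. *)
  apply: (IHp q _ i' ((i + r + 5) %/ 19 - i').+1); rewrite ?/i'; try lia.
  move=> k ltk; pose j := maxn i (19 * (i' + k) - 6).
  have := eqw (j - i); rewrite subnKC ?leq_maxl // wordE [word (j + p)]wordE.
  have -> : (j + p + 6) %% 19 = (j + 6) %% 19 by lia.
  have -> : (j + p + 6) %/ 19 = (j + 6) %/ 19 + q by lia.
  have -> : (j + 6) %/ 19 = i' + k by lia.
  by move=> eqb; apply: addIb (eqb _); lia.
have [p_small | p_large] := ltnP p 9.
  by apply: (word_no_short_period i p); [lia | move=> k lek; apply: eqw; lia].
(* [p >= 9] forces [r >= 13]. *)
have /eqP : i = i + p %[mod 19].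
  by apply: word_synchronizing => k ltk; rewrite addnAC eqw //; lia.
by rewrite -[X in X == _ %[mod _]]addn0 eqn_modDl mod0n eq_sym; move/negP: ndvd.
Qed.

(** A word [u] that is a prefix of [x ++ u] has period [size x]. *)
Lemma prefix_flatten_shift (x x' : seq bool) n : prefix x' x ->
  prefix (flatten (nseq n x) ++ x') (x ++ (flatten (nseq n x) ++ x')).
Proof.
move=> x'x; elim: n => [|n IHn] /=; first exact: prefix_catl.
by rewrite -catA prefix_catr ?eqxx.
Qed.

Lemma power_with_period_nth u p k : is_power_with_period u p -> k + p < size u ->
  nth false u k = nth false u (k + p).
Proof.
case=> x [x' [n [_ [<- [n_gt0 [x'x ->]]]]]]; case: n n_gt0 => // n _ /=.
rewrite -catA => ltk.
have /prefixP := prefix_flatten_shift _ _ n x'x; move: ltk.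
set v := flatten _ ++ x'; rewrite size_cat addnC ltn_add2l => ltk [y eq_xv].
rewrite -[RHS](_ : nth false v k = _); first by rewrite eq_xv nth_cat ltk.
by rewrite nth_cat ltnNge leq_addr /= addKn.
Qed.

Lemma word_plus_power_free : plus_power_free 7 3 word.
Proof.
move=> i m [p [pow]]; rewrite size_mkseq => ltpm.
have p_gt0 : 0 < p by case: pow => x [x' [n [? [<-]]]].
apply: (word_no_long_run p i (m - p)) => // [|k ltk]; first by lia.
have := power_with_period_nth _ _ k pow; rewrite size_mkseq => eqk.
by have := eqk ltac:(lia); rewrite !nth_mkseq ?addnA //; lia.
Qed.

(* From the left end of f^n(0110110), at position - (19^n - 1)/3, the run of
   equalities has length 4 * 19^n, hence the bound 3 * i < 11 * 19^n + 1. *)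
Lemma word_period n i : 3 * i <= 11 * 19 ^ n ->
  word i = word (i + 3 * 19 ^ n).
Proof.
elim: n i => [|n IHn] i; first by case: i => [|[|[|[|i]]]] //; lia.
rewrite expnS => lei; rewrite wordE [RHS]wordE.
have -> : (i + 3 * (19 * 19 ^ n) + 6) %% 19 = (i + 6) %% 19 by lia.
have -> : (i + 3 * (19 * 19 ^ n) + 6) %/ 19 = (i + 6) %/ 19 + 3 * 19 ^ n by lia.
by rewrite -IHn //; lia.
Qed.

Lemma factor_square (w : nat -> bool) i p : 0 < p ->
  (forall k, k < p -> w (i + k) = w (i + k + p)) ->
  is_square (factor w i (p + p)).
Proof.
move=> p_gt0 eqw; exists (factor w i p); split; first by rewrite size_mkseq.
apply: (eq_from_nth (x0 := false)); first by rewrite size_cat !size_mkseq.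
move=> k; rewrite size_mkseq => ltk; rewrite nth_cat size_mkseq nth_mkseq //.
case: ltnP => lekp; first by rewrite nth_mkseq.
have lt_kp : k - p < p by lia.
by rewrite nth_mkseq // (eqw _ lt_kp) -addnA subnK.
Qed.

Theorem theorem4 :
  exists w : nat -> bool,
    plus_power_free 7 3 w /\
    forall i N : nat, exists m : nat,
      N <= m /\ is_square (factor w i m).
Proof.
exists word; split; first exact: word_plus_power_free.
(* Squares of period [3 * 19 ^ n] begin wherever [3 * i <= 2 * 19 ^ n]. *)
move=> i N; have : 3 * i + N < 19 ^ (3 * i + N) by apply: ltn_expl.
move: {2}(3 * i + N) => n ltn.
exists (3 * 19 ^ n + 3 * 19 ^ n); split; first by lia.
apply: factor_square => [|k ltk]; first by lia.
by apply: word_period; lia.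
Qed.
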